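(* Let $s\in\mathbb N$ with $(r-1)\mid s$, and let $\mathfrak n\in A_+$. Then $$\frac{H_{<\deg\mathfrak n}(s;\lambda_{\mathfrak n})}{(\mathfrak n\lambda_{\mathfrak n})^s}=\frac{\mathrm{dBC}_s(\mathfrak n)}{\Gamma_{s+1}}.$$ In particular, $H_{<\deg\mathfrak n}(s;\lambda_{\mathfrak n})\in K\cdot\lambda_{\mathfrak n}^s$.
   Context: Let $r$ be a power of a prime, $A=\mathbb F_r[\theta]$, $K=\mathbb F_r(\theta)$, $\mathbb C_\infty$ the completion of an algebraic closure of $\mathbb F_r((1/\theta))$; $A_+$ monic polynomials, $A_{+,d}$ those of degree $d$. Carlitz module: $a\mapsto\mathbf C_a(X)\in A[X]$ with $\mathbf C_\theta(X)=\theta X+X^r$. $\exp_{\mathbf C}(X)=\sum_{i\ge0}X^{r^i}/D_i$ with $D_i=\prod_{j=0}^{i-1}(\theta^{r^i}-\theta^{r^j})$ (equivalently $D_i=\prod_{a\in A_{+,i}}a$), $\tilde\pi$ the Carlitz period, $\lambda_{\mathfrak n}=\exp_{\mathbf C}(\tilde\pi/\mathfrak n)$. $[a]_u=\mathbf C_a(u)/u$, $H_d(s;u)=\sum_{a\in A_{+,d}}[a]_u^{-s}$, $H_{<d}(s;u)=\sum_{0\le d'<d}H_{d'}(s;u)$. Carlitz factorial: for $n=\sum_dn_dr^d$ with $0\le n_d\le r-1$, $\Gamma_{n+1}=\prod_dD_d^{n_d}$. For nonzero $a\in A$, the degenerate Bernoulli–Carlitz numbers $\mathrm{dBC}_n(a)\in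 K$ are defined by $\dfrac{X}{\mathbf C_a(X/a)}=\sum_{n\ge0}\dfrac{\mathrm{dBC}_n(a)}{\Gamma_{n+1}}X^n$. *)

(* Defs.v *)
From HB Require Import structures.
From mathcomp Require Import all_boot all_order all_algebra.
From mathcomp Require Import all_classical all_reals all_analysis.

Set Implicit Arguments.
Unset Strict Implicit.
Unset Printing Implicit Defensive.
Import Order.TTheory GRing.Theory Num.Theory.
Import numFieldNormedType.Exports.
Local Open Scope classical_set_scope.
Local Open Scope ring_scope.

(* Throughout, F is the field with r elements, A = {poly F} (theta is 'X) and
   K = {fraction {poly F}}. *)

Section FormalPart.
Variable F : finFieldType.
Local Notation r := #|F|.
Local Notation A := {poly F}.
Local Notation K := {fraction {poly F}}.
Local Notation "x %:F" := (tofrac x).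

Definition carlitz_theta : {poly A} := 'X%:P * 'X + 'X^r.

(* a |-> C_a is the F-algebra map sending theta to C_theta, multiplication on
   the target being composition. *)
Definition carlitz (a : A) : {poly A} :=
  \sum_(i < size a)
    (a`_i)%:P *: iter i (fun P : {poly A} => carlitz_theta \Po P) 'X.

Definition Dfact (i : nat) : A := \prod_(j < i) ('X^(r ^ i) - 'X^(r ^ j)).

(* Gamma_succ n is the Carlitz factorial Gamma_{n+1}; the d-th base r digit of
   n vanishes for d > n. *)
Definition Gamma_succ (n : nat) : A :=
  \prod_(d < n.+1) Dfact d ^+ ((n %/ r ^ d) %% r)%N.

(* First n coefficients of the inverse of the power series \sum_i f i X^i. *)
Fixpoint series_inv_seq (f : nat -> K) (n : nat) : seq K :=
  if n is m.+1 then
    let s := series_inv_seq f m in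
    rcons s (((m == 0)%N%:R - \sum_(i < m) f (m - i)%N * s`_i) / f 0%N)
  else [::].

Definition series_inv (f : nat -> K) (n : nat) : K :=
  (series_inv_seq f n.+1)`_n.

Lemma size_series_inv_seq f n : size (series_inv_seq f n) = n.
Proof. by elim: n => //= n IH; rewrite size_rcons IH. Qed.

Lemma nth_series_inv_seq f n i :
  (i < n)%N -> (series_inv_seq f n)`_i = series_inv f i.
Proof.
elim: n => // n IH; rewrite ltnS leq_eqVlt => /orP[/eqP-> //|lt_in].
by rewrite /= nth_rcons size_series_inv_seq lt_in IH.
Qed.

Lemma series_invP f n : f 0%N != 0 ->
  \sum_(i < n.+1) series_inv f i * f (n - i)%N = (n == 0)%N%:R.
Proof.
move=> f0; rewrite big_ord_recr /= subnn.
rewrite {2}/series_inv /= nth_rcons size_series_inv_seq ltnn eqxx divfK //.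
rewrite addrC -addrA [X in _ + X](_ : _ = 0) ?addr0 //.
apply/eqP; rewrite addrC subr_eq0; apply/eqP/eq_bigr => i _.
by rewrite nth_series_inv_seq // mulrC.
Qed.

(* C_a(X / a) in K[X] *)
Definition carlitz_scaled (a : A) : {poly K} :=
  map_poly (@tofrac A) (carlitz a) \Po ((a%:F)^-1 *: 'X).

(* C_a(X / a) has zero constant term, so X / C_a(X / a) is the inverse of the
   series obtained by shifting the coefficients of C_a(X / a) by one. *)
Definition dBC (a : A) (n : nat) : K :=
  (Gamma_succ n)%:F *
  series_inv (fun k => (carlitz_scaled a)`_k.+1) n.

Lemma card_gt1 : (1 < r)%N.
Proof. exact: card_finNzRing_gt1. Qed.

Lemma Dfact_neq0 i : Dfact i != 0.
Proof.
apply/prodf_neq0 => j _; rewrite subr_eq0; apply/eqP => /(congr1 (@size _ \o val)).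
rewrite /= !size_polyXn => -[/eqP]; rewrite eqn_exp2l ?card_gt1 //.
by move/eqP=> eij; have := ltn_ord j; rewrite -eij ltnn.
Qed.

Lemma Gamma_succ_neq0 n : Gamma_succ n != 0.
Proof. by apply/prodf_neq0 => d _; rewrite expf_neq0 ?Dfact_neq0. Qed.

Lemma carlitz_iter_coef01 i :
  let P := iter i (fun P : {poly A} => carlitz_theta \Po P) 'X in
  P`_0 = 0 /\ P`_1 = 'X^i.
Proof.
elim: i => [|i [IH0 IH1]] /=; first by rewrite !coefX expr0.
set P := iter i _ _ in IH0 IH1 *.
have [Q defP] : exists Q, P = Q * 'X.
  have /factor_theorem[Q ->] : root P 0 by rewrite /root horner_coef0 IH0.
  by exists Q; rewrite subr0.
have r1 := card_gt1.
rewrite /carlitz_theta comp_polyD comp_polyM comp_polyC comp_polyX comp_Xn_poly.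
have eP : P ^+ r = Q ^+ r * 'X^r by rewrite defP exprMn.
rewrite !coefD !coefCM IH0 IH1 eP !coefMXn (ltnW r1) r1 mulr0 !addr0.
by rewrite -exprS.
Qed.

Lemma carlitz_coef0 a : (carlitz a)`_0 = 0.
Proof.
rewrite coef_sum big1 // => i _.
by rewrite coefZ (carlitz_iter_coef01 i).1 mulr0.
Qed.

Lemma carlitz_coef1 a : (carlitz a)`_1 = a.
Proof.
rewrite coef_sum -[RHS]coefK poly_def; apply: eq_bigr => i _.
by rewrite coefZ (carlitz_iter_coef01 i).2 mul_polyC.
Qed.

Lemma carlitz_scaled_coef a k :
  (carlitz_scaled a)`_k = ((carlitz a)`_k)%:F / a%:F ^+ k.
Proof.
rewrite /carlitz_scaled comp_polyE coef_sum.
under eq_bigr => i _ do rewrite exprZn !coefZ coefXn.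
have [lt_k|ge_k] := ltnP k (size (map_poly (@tofrac A) (carlitz a))).
  rewrite (bigD1 (Ordinal lt_k)) //= eqxx mulr1 coef_map exprVn big1 ?addr0 //.
  move=> i /eqP ne_ik; case: eqP => [e|_]; last by rewrite !mulr0.
  by case: ne_ik; apply: val_inj.
have := ge_k; rewrite -coef_map => /(nth_default 0) ->.
rewrite mul0r big1 // => i _; case: eqP => [e|_]; last by rewrite !mulr0.
by have := ltn_ord i; rewrite -e ltnNge ge_k.
Qed.

(* The defining identity X = C_a(X / a) * \sum_n dBC_n(a) / Gamma_{n+1} X^n. *)
Lemma dBC_generating a m : a != 0 ->
  \sum_(i < m.+1) dBC a i / (Gamma_succ i)%:F * (carlitz_scaled a)`_(m - i) =
  (m == 1)%N%:R.
Proof.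
move=> a0; rewrite big_ord_recr /= subnn.
rewrite [X in _ * X]carlitz_scaled_coef carlitz_coef0 rmorph0 mul0r mulr0 addr0.
case: m => [|m]; first by rewrite big_ord0.
rewrite eqSS -(@series_invP (fun k => (carlitz_scaled a)`_k.+1) m); last first.
  by rewrite carlitz_scaled_coef carlitz_coef1 expr1 divff ?oner_eq0 ?tofrac_eq0.
apply: eq_bigr => i _; have le_im : (i <= m)%N by rewrite -ltnS.
rewrite subSn //; congr (_ * _).
have G0 : (Gamma_succ i)%:F != 0 by rewrite tofrac_eq0 Gamma_succ_neq0.
by rewrite /dBC (mulrC _ (series_inv _ _)) mulfK.
Qed.

End FormalPart.

(* A field with a real-valued absolute value, an embedding of F, and an element
   playing the role of theta. *)
Record valued_ext (R : realType) (F : finFieldType) := ValuedExt {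
  carrier :> fieldType;
  iota : {rmorphism F -> carrier};
  theta : carrier;
  abs : carrier -> R }.

Section AnalyticPart.
Variables (R : realType) (F : finFieldType) (C : valued_ext R F).
Local Notation r := #|F|.
Local Notation A := {poly F}.
Local Notation K := {fraction {poly F}}.

Definition converges (u : nat -> C) (l : C) : Prop :=
  (fun m => abs (u m - l)) @ \oo --> (0 : R).

Definition cauchy_seq (u : nat -> C) : Prop :=
  forall e : R, 0 < e -> exists N : nat, forall m n : nat,
    (N <= m)%N -> (N <= n)%N -> abs (u m - u n) < e.

(* The copy of F((1/theta)) inside C: sums of Laurent series
   \sum_i c_i theta^(N - i). *)
Definition Kinfty : set C := [set x | exists (N : nat) (c : nat -> F),
  converges
    (fun m => \sum_(i < m) iota C (c i) * theta C ^+ N / theta C ^+ i) x].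

Definition Kinfty_algebraic : set C := [set x | exists p : {poly C},
  [/\ forall i, Kinfty p`_i, p != 0 & root p x]].

(* C is a completion of an algebraic closure of F((1/theta)); the absolute value
   is normalised by |theta| = r. *)
Record is_Cinfty : Prop := IsCinfty {
  abs_ge0 : forall x : C, 0 <= abs x;
  abs_eq0 : forall x : C, abs x = 0 <-> x = 0;
  absM : forall x y : C, abs (x * y) = abs x * abs y;
  absD : forall x y : C, abs (x + y) <= Num.max (abs x) (abs y);
  abs_theta : abs (theta C) = r%:R;
  Cinfty_complete : forall u : nat -> C, cauchy_seq u ->
    exists l : C, converges u l;
  Kinfty_closure : forall p : {poly C},
    (forall i, Kinfty_algebraic p`_i) -> (1 < size p)%N ->
    exists2 x : C, Kinfty_algebraic x & root p x;
  Kinfty_dense : forall (x : C) (e : R), 0 < e ->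
    exists2 y : C, Kinfty_algebraic y & abs (x - y) < e }.

Definition evA (a : A) : C := (map_poly (iota C) a).[theta C].

Definition evK (x : K) : C := evA (frac (repr x)).1 / evA (frac (repr x)).2.

(* exp_C(z); the default value 0 of xget is used only if the series diverges,
   which never happens when C is C_infty. *)
Definition expC (z : C) : C :=
  xget 0 [set w | converges
    (fun m => \sum_(i < m) z ^+ (r ^ i) / evA (Dfact F i)) w].

(* A generator of the rank one A-lattice ker(exp_C), unique up to F^*. *)
Definition carlitz_period (pi : C) : Prop :=
  pi != 0 /\ forall z : C, expC z = 0 <-> exists a : A, z = evA a * pi.

Definition carlitz_eval (a : A) (u : C) : C := (map_poly evA (carlitz a)).[u].

Definition bracket (a : A) (u : C) : C := carlitz_eval a u / u.

Definition Hsum (d s : nat) (u : C) : C :=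
  \sum_(a : {poly_(d.+1) F} | ((a : A) \is monic) && (size (a : A) == d.+1))
    bracket a u ^- s.

Definition Hsum_lt (d s : nat) (u : C) : C := \sum_(d' < d) Hsum d' s u.

Definition lambda (pi : C) (n : A) : C := expC (pi / evA n).

End AnalyticPart.

(* Main.v *)
(* By the functional equation of the Carlitz exponential, C_a(lambda) equals
   exp_C(a pi / n); hence C_n(X) = \prod_(deg a < deg n) (X - C_a(lambda)).
   Its derivative is the constant n, so the logarithmic derivative gives
     n / C_n(X) = \sum_(deg a < deg n) 1 / (X - C_a(lambda)),
   and expanding at X = 0 identifies the coefficients of X / C_n(X / n) with
   minus the power sums of the inverses (n C_a(lambda))^-1, a != 0.  When r - 1
   divides s these power sums are F^*-invariant, and summing over each line
   F^* a contributes the factor r - 1 = -1. *)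

Require Import Defs.
From HB Require Import structures.
From mathcomp Require Import all_boot all_order all_algebra all_field.
From mathcomp Require Import all_classical all_reals all_analysis.
From mathcomp Require Import ring lra.
Set Implicit Arguments.
Unset Strict Implicit.
Unset Printing Implicit Defensive.
Import Order.TTheory GRing.Theory Num.Theory.
Import numFieldNormedType.Exports.
Local Open Scope ring_scope.

(** * Convolution recurrences and logarithmic derivatives *)

(** As [p 0 = 0], the last surviving term of the equation at [m.+1] is [b m * p 1], so the equation
    determines [b m] from the earlier values. *)
Lemma convolution_inj (L : fieldType) (p b b' : nat -> L) :
  p 0 = 0 -> p 1 != 0 ->
  (forall m, \sum_(i < m.+1) b i * p (m - i)%N
           = \sum_(i < m.+1) b' i * p (m - i)%N) ->
  forall m, b m = b' m.
Proof.
move=> p0 p1 h; elim/ltn_ind => m IH.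
have := h m.+1; rewrite !big_ord_recr /= subnn p0 !mulr0 !addr0 subSnn.
rewrite (eq_bigr (fun i : 'I_m => b' i * p (m.+1 - i)%N)); last first.
  by move=> i _; rewrite IH.
by move=> /addrI/(mulIf p1).
Qed.

(** Coefficientwise form of the geometric series 1 / (X - x) = - \sum_j x^-(j+1) X^j multiplied by
    p; the quotient is exact because x is a root. *)
Lemma coef_divp_XsubC (L : fieldType) (p : {poly L}) (x : L) (k : nat) :
  root p x -> x != 0 ->
  (p %/ ('X - x%:P))`_k = - \sum_(j < k.+1) p`_j * x ^- (k.+1 - j).
Proof.
move=> /factor_theorem[q ->] x0; rewrite mulpK ?polyXsubC_eq0 //.
set p' := q * _.
have p'0 : p'`_0 = - (x * q`_0).
  by rewrite /p' mulrBr coefB coefMX coefMC sub0r mulrC.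
have p'S i : p'`_i.+1 = q`_i - x * q`_i.+1.
  by rewrite /p' mulrBr coefB coefMX coefMC mulrC.
elim: k => [|k IH].
  rewrite big_ord_recr big_ord0 /= add0r subn0 p'0 mulNr opprK expr1.
  by rewrite mulrC mulKf.
rewrite big_ord_recr /= subSnn expr1 p'S.
rewrite (eq_bigr (fun j : 'I_k.+1 => p'`_j * x ^- (k.+1 - j) * x^-1));
  last first.
  by move=> j _; rewrite subSn ?exprSr ?invfM ?mulrA // ltnW.
rewrite -mulr_suml -[X in X * _ + _]opprK -IH.
by field.
Qed.

(** Logarithmic derivative of a product of linear factors. The root 0 is kept apart, since its term
    p / X only shifts coefficients; the other terms expand as geometric series at 0. *)
Lemma deriv_prod_XsubC_coef (L : fieldType) (rs : seq L) (k : nat) :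
  (forall x, x \in rs -> x != 0) ->
  let p := \prod_(x <- rs) ('X - x%:P) * 'X in
  p^`()`_k = p`_k.+1
    - \sum_(j < k.+1) p`_j * \sum_(x <- rs) x ^- (k.+1 - j).
Proof.
move=> rs0 p.
have dp : p^`() = \prod_(x <- rs) ('X - x%:P)
   + \sum_(x <- rs) p %/ ('X - x%:P).
  rewrite /p; elim: rs rs0 {p} => [|x rs IH] rs0.
    by rewrite !big_nil mul1r derivX addr0.
  rewrite !big_cons -!mulrA derivM IH; last first.
    by move=> y yrs; apply: rs0; rewrite inE yrs orbT.
  rewrite derivXsubC mul1r mulrDr addrCA mulKp ?polyXsubC_eq0 //.
  congr (_ + (_ + _)).
  rewrite big_distrr /=; apply: eq_big_seq => y yrs.
  have /dvdpP[q ->] : 'X - y%:P %| \prod_(j <- rs) ('X - j%:P) * 'X.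
    by rewrite dvdp_mulr // dvdp_XsubCl root_prod_XsubC.
  by rewrite mulrA !mulpK // polyXsubC_eq0.
rewrite dp coefD [p`_k.+1]coefMX /= coef_sum; congr (_ + _).
under [X in - X]eq_bigr => j _ do rewrite mulr_sumr.
rewrite exchange_big /= -sumrN; apply: eq_big_seq => x xrs.
by rewrite coef_divp_XsubC ?rs0 // rootM root_prod_XsubC xrs.
Qed.

(** * Frobenius and the constants D_i *)

Section FiniteField.
Variable F : finFieldType.
Local Notation r := #|F|.

(** The morphism [f] carries the characteristic of F over to L, and r is a power of that prime; the
    Frobenius lemmas below take [f] for the same reason. *)
Lemma pchar_pnat_card (L : comNzRingType) (f : {rmorphism F -> L}) :
  [pchar L].-nat r.
Proof.
have [p pr_p pF] := finPcharP F.
rewrite (card_pprimeChar pF) (eq_pnat _ (pcharf_eq (rmorph_pchar f pF))).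
by rewrite pnatX pnat_id.
Qed.

Lemma exprD_card (L : comNzRingType) (f : {rmorphism F -> L}) i (x y : L) :
  (x + y) ^+ (r ^ i) = x ^+ (r ^ i) + y ^+ (r ^ i).
Proof. by rewrite exprDn_pchar // pnatX (pchar_pnat_card f). Qed.

Lemma exprN_card (L : comNzRingType) (f : {rmorphism F -> L}) i (x : L) :
  (- x) ^+ (r ^ i) = - x ^+ (r ^ i).
Proof.
apply/eqP; rewrite -addr_eq0 -exprD_card // addNr expr0n expn_eq0.
by rewrite -leqn0 leqNgt (ltnW (card_gt1 F)).
Qed.

Lemma natr_card_eq0 (L : comNzRingType) (f : {rmorphism F -> L}) :
  r%:R = 0 :> L.
Proof.
have [p pr_p pF] := finPcharP F; have pL := rmorph_pchar f pF.
apply/eqP; rewrite -(dvdn_pcharf pL).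
have := card_gt1 F; rewrite (card_pprimeChar pF).
by case: logn => // k _; rewrite expnS dvdn_mulr.
Qed.

Lemma expf_card_iter i (c : F) : c ^+ (r ^ i) = c.
Proof. by elim: i => [|i IH]; rewrite ?expr1 // expnS exprM expf_card. Qed.

(** The group of units of F has order r - 1. This yields both the invariance of the power sums under
    scaling and |c| = 1 for nonzero constants. *)
Lemma expf_card_dvd s (c : F) : (r.-1 %| s)%N -> c != 0 -> c ^+ s = 1.
Proof.
move=> /dvdnP[k ->] c0; rewrite mulnC exprM.
suff -> : c ^+ r.-1 = 1 by rewrite expr1n.
by apply: (mulfI c0); rewrite -exprS mulr1 prednK ?expf_card // ltnW ?card_gt1.
Qed.

(** The factor j = 0 is split off; by Frobenius each remaining factor is the r-th power of a factor
    of D_i. *)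
Lemma DfactS i :
  Dfact F i.+1 = ('X^(r ^ i.+1) - 'X) * Dfact F i ^+ r.
Proof.
rewrite /Dfact big_ord_recl expn0 expr1 -prodrXl; congr (_ * _).
apply: eq_bigr => j _; rewrite -[r in RHS]expn1.
rewrite (exprD_card (polyC : {rmorphism F -> {poly F}})).
rewrite (exprN_card (polyC : {rmorphism F -> {poly F}})) !expn1.
by rewrite -!exprM -!expnSr.
Qed.

End FiniteField.

(** * The ultrametric absolute value and the embedding of A *)

Section Valued.
Variables (R : realType) (F : finFieldType) (C : valued_ext R F).
Hypothesis hC : is_Cinfty C.
Local Notation r := #|F|.
Local Notation abs := (@abs R F C).

Let abs_ge0 (x : C) : 0 <= abs x. Proof. exact: abs_ge0. Qed.
Let abs_eq0 (x : C) : abs x = 0 <-> x = 0. Proof. exact: abs_eq0. Qed.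
Let absM (x y : C) : abs (x * y) = abs x * abs y. Proof. exact: absM. Qed.
Let absD (x y : C) : abs (x + y) <= Num.max (abs x) (abs y).
Proof. exact: absD. Qed.

Lemma abs0 : abs 0 = 0.
Proof. by apply/abs_eq0. Qed.

Lemma abs_eq0P (x : C) : (abs x == 0) = (x == 0).
Proof. by apply/eqP/eqP => /abs_eq0. Qed.

Lemma abs1 : abs 1 = 1.
Proof.
have a0 : abs 1 != 0 by rewrite abs_eq0P oner_eq0.
by apply: (mulfI a0); rewrite -absM !mulr1.
Qed.

Lemma absX n (x : C) : abs (x ^+ n) = abs x ^+ n.
Proof. by elim: n => [|n IH]; rewrite ?expr0 ?abs1 // !exprS absM IH. Qed.

Lemma absV (x : C) : abs x^-1 = (abs x)^-1.
Proof.
have [->|x0] := eqVneq x 0; first by rewrite invr0 abs0 invr0.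
have a0 : abs x != 0 by rewrite abs_eq0P.
by apply: (mulfI a0); rewrite -absM !divff // abs1.
Qed.

Lemma abs_expn_eq1 n (x : C) : (0 < n)%N -> x ^+ n = 1 -> abs x = 1.
Proof.
move=> n0 /(congr1 abs); rewrite absX abs1 => /eqP.
by rewrite pexpr_eq1 // => /eqP.
Qed.

Lemma absN (x : C) : abs (- x) = abs x.
Proof.
by rewrite -mulN1r absM (@abs_expn_eq1 2 (-1)) ?mul1r // sqrrN expr1n.
Qed.

Lemma absB (x y : C) : abs (x - y) <= Num.max (abs x) (abs y).
Proof. by rewrite -(absN y) absD. Qed.

Lemma absD_lt (e : R) (x y : C) : abs x < e -> abs y < e -> abs (x + y) < e.
Proof. by move=> xe ye; rewrite (le_lt_trans (absD _ _)) // gt_max xe. Qed.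

(** Writing x = (x + y) - y bounds |x| by the larger of |x + y| and |y|, and |y| is too small to be
    that bound. *)
Lemma absDl (x y : C) : abs y < abs x -> abs (x + y) = abs x.
Proof.
move=> yx; apply/eqP; rewrite eq_le; apply/andP; split.
  by rewrite (le_trans (absD _ _)) // ge_max lexx ltW.
have := absB (x + y) y; rewrite addrK le_max => /orP[//|].
by rewrite leNgt yx.
Qed.

Lemma abs_iota (c : F) : c != 0 -> abs (Defs.iota C c) = 1.
Proof.
move=> c0; apply: (@abs_expn_eq1 r.-1).
  by rewrite -subn1 subn_gt0 card_gt1.
by rewrite -rmorphXn /= expf_card_dvd // rmorph1.
Qed.

Lemma evA_is_nmod_morphism : nmod_morphism (evA C).
Proof.
by split=> [|a b]; rewrite /evA ?rmorph0 ?horner0 // rmorphD hornerD.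
Qed.

Lemma evA_is_monoid_morphism : monoid_morphism (evA C).
Proof.
by split=> [|a b]; rewrite /evA ?rmorph1 ?hornerC // rmorphM hornerM.
Qed.

HB.instance Definition _ := GRing.isNmodMorphism.Build {poly F} C (evA C)
  evA_is_nmod_morphism.
HB.instance Definition _ := GRing.isMonoidMorphism.Build {poly F} C (evA C)
  evA_is_monoid_morphism.

Lemma evAX : evA C 'X = theta C.
Proof. by rewrite /evA map_polyX hornerX. Qed.

Lemma evAC c : evA C c%:P = Defs.iota C c.
Proof. by rewrite /evA map_polyC hornerC. Qed.

Lemma evAZ c a : evA C (c *: a) = Defs.iota C c * evA C a.
Proof. by rewrite -mul_polyC rmorphM /= evAC. Qed.

Let r1 : 1 < r%:R :> R. Proof. by rewrite ltr1n card_gt1. Qed.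
Let r0 : 0 < r%:R :> R. Proof. exact: lt_trans r1. Qed.

(** Nonzero constants have absolute value 1 and |theta| = r > 1, so the leading term dominates at
    each Horner step. Injectivity of [evA] follows. *)
Lemma abs_evA (a : {poly F}) : a != 0 -> abs (evA C a) = r%:R ^+ (size a).-1.
Proof.
elim/poly_ind: a => [|a c IH]; first by rewrite eqxx.
have [->|a0] := eqVneq a 0.
  rewrite mul0r add0r polyC_eq0 evAC => c0.
  by rewrite size_polyC c0 abs_iota.
move=> _; rewrite size_MXaddC (negPf a0) /=.
have aX : abs (evA C (a * 'X)) = r%:R ^+ size a.
  rewrite rmorphM absM IH //= evAX abs_theta // -exprSr prednK //.
  by rewrite lt0n size_poly_eq0.
rewrite rmorphD absDl ?aX //= evAC.
apply: (@le_lt_trans _ _ 1).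
  by have [->|c0] := eqVneq c 0; rewrite ?rmorph0 ?abs0 ?ler01 // abs_iota.
by rewrite exprn_egt1 // -lt0n lt0n size_poly_eq0.
Qed.

Lemma evA_eq0 (a : {poly F}) : (evA C a == 0) = (a == 0).
Proof.
apply/eqP/eqP => [|->]; last exact: rmorph0.
move/eqP; rewrite -abs_eq0P; apply: contraTeq => a0.
by rewrite abs_evA // expf_neq0 // gt_eqF.
Qed.

Lemma evA_inj : injective (evA C).
Proof.
move=> a b /eqP; rewrite -subr_eq0 -rmorphB evA_eq0 subr_eq0; exact: eqP.
Qed.

(** D_i has degree i r^i: by [DfactS] the degree of D_{i+1} is r^(i+1) + r (i r^i). *)
Lemma abs_Dfact i : abs (evA C (Dfact F i)) = (r%:R ^+ i) ^+ (r ^ i).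
Proof.
rewrite abs_evA ?Dfact_neq0 // -exprM; congr (_ ^+ _).
elim: i => [|i IH]; first by rewrite /Dfact big_ord0 size_poly1.
have X1 : size ('X^(r ^ i.+1) - 'X : {poly F}) = (r ^ i.+1).+1.
  rewrite size_polyDl ?size_polyN ?size_polyX ?size_polyXn // ltnS.
  by rewrite (leq_trans (card_gt1 F)) // -{1}(expn1 r) leq_exp2l ?card_gt1.
rewrite DfactS size_proper_mul; last first.
  rewrite mulf_neq0 ?lead_coef_eq0 ?expf_neq0 ?Dfact_neq0 //.
  by rewrite -size_poly_eq0 X1.
have D1 : size (Dfact F i ^+ r) = (i * r ^ i * r).+1.
  by rewrite -IH -size_exp prednK // lt0n size_poly_eq0 expf_neq0 ?Dfact_neq0.
by rewrite X1 D1 addSn addnS /= mulSn expnSr mulnA.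
Qed.

End Valued.

(** * Convergence and functional equation of the Carlitz exponential *)

Section Exponential.
Variables (R : realType) (F : finFieldType) (C : valued_ext R F).
Hypothesis hC : is_Cinfty C.
Local Notation r := #|F|.
Local Notation abs := (@abs R F C).

Let abs_ge0 (x : C) : 0 <= abs x. Proof. exact: abs_ge0. Qed.

Lemma convergesP (u : nat -> C) (l : C) : converges u l <->
  forall e : R, 0 < e -> exists N, forall m, (N <= m)%N -> abs (u m - l) < e.
Proof.
split=> [/cvgrPdist_lt h e e0|h].
  have [N _ hN] := h e e0; exists N => m Nm.
  by have := hN m Nm; rewrite /= sub0r normrN ger0_norm.
apply/cvgrPdist_lt => e e0; have [N hN] := h e e0.
by exists N => // m Nm /=; rewrite sub0r normrN ger0_norm ?hN.
Qed.

Lemma converges_uniq (u : nat -> C) (l l' : C) :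
  converges u l -> converges u l' -> l = l'.
Proof.
move=> /convergesP h /convergesP h'.
apply/eqP; rewrite -subr_eq0 -(abs_eq0P hC) eq_le abs_ge0 andbT leNgt.
apply/negP => e0; have [N hN] := h _ e0; have [N' hN'] := h' _ e0.
have := absD_lt hC (hN' _ (leq_maxr N N')) _.
move=> /(_ (l - u (maxn N N'))); rewrite -(absN hC) opprB.
move=> /(_ (hN _ (leq_maxl N N'))).
by rewrite addrC subrKA ltxx.
Qed.

Lemma convergesD (u v : nat -> C) (l l' : C) :
  converges u l -> converges v l' -> converges (fun m => u m + v m) (l + l').
Proof.
move=> /convergesP h /convergesP h'; apply/convergesP => e e0.
have [N hN] := h _ e0; have [N' hN'] := h' _ e0.
exists (maxn N N') => m; rewrite geq_max => /andP[/hN h1 /hN' h2].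
by rewrite opprD addrACA absD_lt.
Qed.

Lemma convergesZ (c : C) (u : nat -> C) (l : C) :
  converges u l -> converges (fun m => c * u m) (c * l).
Proof.
move=> /convergesP h; apply/convergesP => e e0.
have c1 : 0 < abs c + 1 by rewrite ltr_wpDl.
have [|N hN] := h (e / (abs c + 1)); first exact: divr_gt0.
exists N => m /hN; rewrite -mulrBr (absM hC) ltr_pdivlMr //.
by apply: le_lt_trans; rewrite mulrC ler_wpM2l // lerDl.
Qed.

Lemma convergesS (u : nat -> C) (l : C) :
  converges u l -> converges (fun m => u m.+1) l.
Proof.
move=> /convergesP h; apply/convergesP => e /h[N hN].
by exists N => m Nm; rewrite hN // leqW.
Qed.

(** Frobenius turns the difference of r-th powers into the r-th power of the difference. *)
Lemma converges_exp_card (u : nat -> C) (l : C) :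
  converges u l -> converges (fun m => u m ^+ r) (l ^+ r).
Proof.
move=> /convergesP h; apply/convergesP => e e0.
(* The bound 1 ensures that raising the difference to the power r does not enlarge it. *)
have [|N hN] := h (Num.min e 1); first by rewrite lt_min e0 ltr01.
exists N => m /hN; rewrite lt_min => /andP[he h1].
have -> : u m ^+ r - l ^+ r = (u m - l) ^+ r.
  rewrite -[r]expn1 (exprD_card (Defs.iota C)).
  by rewrite (exprN_card (Defs.iota C)).
rewrite (absX hC) (le_lt_trans _ he) // ler_iXnr ?(ltW h1) //.
by rewrite (ltnW (card_gt1 F)).
Qed.

Definition exp_sum (z : C) (m : nat) : C :=
  \sum_(i < m) z ^+ (r ^ i) / evA C (Dfact F i).

(** By [abs_Dfact] the i-th term has absolute value (|z| / r^i)^(r^i). Once the base is at most 1/2,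
    it is bounded by 2^-(r^i), hence by 2^-i. *)
Lemma exp_term_small (z : C) (e : R) : 0 < e ->
  exists N, forall i, (N <= i)%N ->
    abs (z ^+ (r ^ i) / evA C (Dfact F i)) < e.
Proof.
move=> e0; have half : `|2^-1 : R| < 1 by rewrite ger0_norm; lra.
have pow d : 0 < d -> exists N, forall i, (N <= i)%N -> (2^-1 : R) ^+ i < d.
  move=> d0; have /cvgrPdist_lt/(_ d d0)[N _ hN] := cvg_expr half.
  by exists N => i /hN /=; rewrite sub0r normrN ger0_norm
    ?exprn_ge0 ?invr_ge0 ?ler0n.
have z1 : 0 < abs z + 1 by rewrite ltr_wpDl.
(* This threshold makes |z| 2^-i at most |z| / (2 (|z| + 1)), hence at most 1/2; the added 1 covers
   z = 0. *)
have [|N hN] := pow ((2 * (abs z + 1))^-1); first by rewrite invr_gt0; lra.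
have [N' hN'] := pow e e0.
exists (maxn N N') => i; rewrite geq_max => /andP[/hN h /hN'].
apply: le_lt_trans.
rewrite (absM hC) (absV hC) (abs_Dfact hC) !(absX hC) -exprVn -exprMn.
apply: (@le_trans _ _ (2^-1 ^+ (r ^ i))); last first.
  apply: ler_wiXn2l; [lra|lra|].
  by rewrite ltnW // ltn_expl // card_gt1.
rewrite lerXn2r ?nnegrE ?mulr_ge0 ?invr_ge0 ?exprn_ge0 ?ler0n //.
have le2 : (r%:R ^+ i)^-1 <= 2^-1 ^+ i :> R.
  rewrite exprVn lef_pV2 ?posrE ?exprn_gt0 ?ltr0n // ?(ltnW (card_gt1 F)) //.
  by rewrite lerXn2r ?nnegrE ?ler0n // ler_nat card_gt1.
apply: (le_trans (ler_wpM2l (abs_ge0 z) le2)).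
apply: (le_trans (ler_wpM2l (abs_ge0 z) (ltW h))).
by rewrite ler_pdivrMr ?mulr_gt0 // mulrA mulVf // mul1r lerDl.
Qed.

(** Partial sums are Cauchy as soon as the terms tend to 0. Completeness then gives a limit, so
    [xget] returns a true limit and not its default. *)
Lemma expC_converges (z : C) : converges (exp_sum z) (expC z).
Proof.
rewrite /expC; apply: xgetPex; apply: (Cinfty_complete hC) => e e0.
have [N hN] := exp_term_small z e0.
(* In an ultrametric a block of terms is no larger than its largest term, whatever its length. *)
have tail k : abs (exp_sum z (N + k) - exp_sum z N) < e.
  elim: k => [|k IH]; first by rewrite addn0 subrr (abs0 hC).
  rewrite addnS [exp_sum z _.+1]big_ord_recr /= addrAC.
  by rewrite absD_lt // hN // leq_addr.
exists N => m n Nm Nn; rewrite -/(exp_sum z m) -/(exp_sum z n).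
rewrite -(subnKC Nm) -(subnKC Nn) -(subrKA (exp_sum z N)).
by rewrite (absD_lt hC) ?tail // -(absN hC) opprB tail.
Qed.

Lemma expC_unique (z l : C) : converges (exp_sum z) l -> expC z = l.
Proof. by move=> /(converges_uniq (expC_converges z)). Qed.

Lemma expCD (x y : C) : expC (x + y) = expC x + expC y.
Proof.
apply: expC_unique.
rewrite (_ : exp_sum _ = fun m => exp_sum x m + exp_sum y m).
  by apply: convergesD; apply: expC_converges.
apply/funext => m; rewrite -big_split; apply: eq_bigr => i _ /=.
by rewrite (exprD_card (Defs.iota C)) mulrDl.
Qed.

Lemma expC_iota (c : F) (z : C) :
  expC (Defs.iota C c * z) = Defs.iota C c * expC z.
Proof.
apply: expC_unique.
rewrite (_ : exp_sum _ = fun m => Defs.iota C c * exp_sum z m).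
  by apply: convergesZ; apply: expC_converges.
apply/funext => m; rewrite mulr_sumr; apply: eq_bigr => i _ /=.
by rewrite exprMn -rmorphXn /= expf_card_iter mulrA.
Qed.

(** The limit of an exact identity between partial sums, whose coefficients match by the recursion
    [DfactS]. *)
Lemma expC_theta (z : C) :
  expC (theta C * z) = theta C * expC z + expC z ^+ r.
Proof.
apply: (@converges_uniq (fun m => exp_sum (theta C * z) m.+1)).
  exact/convergesS/expC_converges.
(* The r-th power raises the index of a term by one, so it involves one term fewer than the other
   sums. *)
rewrite (_ : (fun m => _) =
  fun m => theta C * exp_sum z m.+1 + exp_sum z m ^+ r).
  apply: convergesD; last exact/converges_exp_card/expC_converges.
  exact/convergesZ/convergesS/expC_converges.
apply/funext => m.
elim: m => [|m IH].
  rewrite /exp_sum !big_ord_recr !big_ord0 /= /Dfact big_ord0 rmorph1 expn0.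
  by rewrite !expr1 !divr1 !add0r expr0n eqn0Ngt (ltnW (card_gt1 F)) addr0.
rewrite {1}/exp_sum big_ord_recr -/(exp_sum _ _) /= IH.
rewrite [exp_sum z m.+2]big_ord_recr [in RHS]/exp_sum -/(exp_sum _ _) /=.
rewrite [X in _ = _ + X ^+ _]big_ord_recr -/(exp_sum _ _) /=.
rewrite -[r in _ = _ + (_ + _) ^+ r]expn1 (exprD_card (Defs.iota C)) expn1.
rewrite mulrDr [RHS]addrACA; congr (_ + _).
rewrite DfactS rmorphM rmorphB !rmorphXn /= (evAX C) exprMn.
have D0 : evA C (Dfact F m) != 0 by rewrite (evA_eq0 hC) Dfact_neq0.
have T0 : theta C ^+ (r ^ m.+1) - theta C != 0.
  rewrite -(evAX C) -rmorphXn -rmorphB (evA_eq0 hC).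
  have := Dfact_neq0 F m.+1; rewrite DfactS mulf_eq0 negb_or => /andP[-> //].
rewrite expr_div_n -exprM -expnSr.
by field; rewrite T0 expf_neq0.
Qed.

End Exponential.

(** * Degree, leading coefficient and derivative of Carlitz polynomials *)

Section Carlitz.
Variable F : finFieldType.
Local Notation r := #|F|.
Local Notation A := {poly F}.
Local Notation it i :=
  (iter i (fun P : {poly A} => carlitz_theta F \Po P) 'X).

Lemma carlitz_thetaE (P : {poly A}) :
  carlitz_theta F \Po P = 'X%:P * P + P ^+ r.
Proof.
by rewrite comp_polyD comp_polyM comp_polyC comp_polyX comp_Xn_poly.
Qed.

(** The power P^r dominates theta P, so each iteration multiplies the degree by r and preserves
    monicity. *)
Lemma carlitz_iter_monic i : it i \is monic /\ size (it i) = (r ^ i).+1.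
Proof.
elim: i => [|i [IHm IHs]] /=; first by rewrite monicX size_polyX.
rewrite carlitz_thetaE.
have sr : size (it i ^+ r) = (r ^ i.+1).+1.
  rewrite expnSr -[(r ^ i)%N]/((r ^ i).+1.-1) -IHs -size_exp prednK //.
  by rewrite size_poly_gt0 monic_neq0 // monic_exp.
have slt : (size ('X%:P * it i)%R < size (it i ^+ r)%R)%N.
  rewrite mul_polyC sr ltnS.
  rewrite (leq_trans (size_scale_leq _ _)) // IHs.
  by rewrite ltn_exp2l ?card_gt1.
rewrite addrC size_polyDl // sr; split => //.
by rewrite monicE lead_coefDl // -monicE monic_exp.
Qed.

Lemma deriv_carlitz_iter i : (it i)^`() = ('X^i)%:P.
Proof.
elim: i => [|i IH] /=; first by rewrite derivX.
rewrite carlitz_thetaE derivD derivM derivC mul0r add0r IH deriv_exp.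
rewrite -[_ *+ r]mulr_natr.
have -> : r%:R = 0 :> {poly A}.
  exact: (natr_card_eq0 (polyC \o polyC : {rmorphism F -> {poly A}})).
by rewrite mulr0 addr0 exprS polyCM.
Qed.

(** The derivative of P^r vanishes in characteristic dividing r, so each iterate of C_theta only
    contributes a factor theta. The constant derivative is what makes the logarithmic derivative of
    C_n equal to n / C_n. *)
Lemma deriv_carlitz (a : A) : (carlitz a)^`() = a%:P.
Proof.
rewrite /carlitz raddf_sum -[a in RHS]coefK poly_def raddf_sum /=.
apply: eq_bigr => i _; rewrite derivZ deriv_carlitz_iter.
by rewrite -!mul_polyC polyCM.
Qed.

Lemma carlitz_monic (a : A) : a \is monic ->
  carlitz a \is monic /\ size (carlitz a) = (r ^ (size a).-1).+1.
Proof.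
move=> am; rewrite /carlitz.
have a0 : (0 < size a)%N by rewrite size_poly_gt0 monic_neq0.
have := eqP am; rewrite lead_coefE; move: a0.
case: (size a) => // d _ /= ad; rewrite big_ord_recr /= ad scale1r.
have [itm its] := carlitz_iter_monic d.
set S := \sum_(i < d) _.
have ltS : (size S < size (it d))%N.
  rewrite its ltnS; apply: (leq_trans (size_sum _ _ _)).
  apply/bigmax_leqP => i _; apply: leq_trans (size_scale_leq _ _) _.
  by rewrite (carlitz_iter_monic i).2 ltn_exp2l ?card_gt1.
rewrite addrC size_polyDl // its; split=> //.
by rewrite monicE lead_coefDl // -monicE.
Qed.

End Carlitz.

(** * The Carlitz action on values of exp_C, and the embedding of K *)

Lemma fraction_repr (A : idomainType) (x : {fraction A}) :
  x = tofrac (frac (repr x)).1 / tofrac (frac (repr x)).2.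
Proof.
unlock tofrac; rewrite -[_^-1]FracField.pi_inv -[RHS]FracField.pi_mul.
rewrite /FracField.mulf /FracField.invf.
rewrite !numden_Ratio ?oner_eq0 ?denom_ratioP // mulr1 mul1r.
by rewrite FracField.Ratio_numden reprK.
Qed.

Section Torsion.
Variables (R : realType) (F : finFieldType) (C : valued_ext R F).
Hypothesis hC : is_Cinfty C.
Local Notation r := #|F|.
Local Notation A := {poly F}.

(** Both sides are F-linear in a, and for a = theta^i the identity iterates the functional
    equation. *)
Lemma carlitz_eval_expC (a : A) (z : C) :
  carlitz_eval a (expC z) = expC (evA C a * z).
Proof.
have exp0 : expC (0 : C) = 0.
  by apply: (addrI (expC 0)); rewrite -(expCD hC) !addr0.
have iterE i : (map_poly (evA C)
    (iter i (fun P : {poly A} => carlitz_theta F \Po P) 'X)).[expC z]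
    = expC (theta C ^+ i * z).
  elim: i => [|i IH] /=; first by rewrite map_polyX hornerX mul1r.
  rewrite carlitz_thetaE rmorphD rmorphM rmorphXn /= map_polyC /= evAX.
  by rewrite !hornerE IH -(expC_theta hC) exprS mulrA.
rewrite /carlitz_eval /carlitz rmorph_sum horner_sum.
under eq_bigr => i _ do
  rewrite /= map_polyZ hornerZ iterE /= evAC -(expC_iota hC) mulrA.
rewrite -[a in RHS]coefK poly_def rmorph_sum mulr_suml /=.
elim/big_rec2: _ => [|i y w _ ->]; first by rewrite exp0.
by rewrite (expCD hC) evAZ rmorphXn /= evAX.
Qed.

(** [evK] uses a chosen representative; cross-multiplication shows independence of the choice, as
    [evA] maps nonzero denominators to nonzero elements. *)
Lemma evK_frac (p q : A) : q != 0 ->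
  evK C (tofrac p / tofrac q) = evA C p / evA C q.
Proof.
move=> q0; rewrite /evK; set x := tofrac p / _.
have xq : x * tofrac q = tofrac p by rewrite divfK ?tofrac_eq0.
have v0 : (frac (repr x)).2 != 0 := denom_ratioP _.
have xv : x * tofrac (frac (repr x)).2 = tofrac (frac (repr x)).1.
  by rewrite {1}(fraction_repr x) divfK ?tofrac_eq0.
move: (frac _).1 (frac _).2 v0 xv => u v v0 xv; clearbody x.
have e : u * q = p * v.
  apply/eqP; rewrite -tofrac_eq !tofracM -xv -xq; apply/eqP.
  exact: mulrAC.
by apply/eqP; rewrite eqr_div ?(evA_eq0 hC) // -!rmorphM /= e.
Qed.

Lemma evK_is_nmod_morphism : nmod_morphism (evK C).
Proof.
split=> [|x y].
  rewrite -[0](mul0r (tofrac 1)^-1) -tofrac0 evK_frac ?oner_eq0 //.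
  by rewrite rmorph0 mul0r.
rewrite (fraction_repr x) (fraction_repr y).
set u := (frac _).1; set v := (frac _).2.
set u' := (frac _).1; set v' := (frac _).2.
have v0 : v != 0 by exact: denom_ratioP.
have v'0 : v' != 0 by exact: denom_ratioP.
rewrite addf_div ?tofrac_eq0 // -!tofracM -tofracD !evK_frac ?mulf_neq0 //.
by rewrite addf_div ?(evA_eq0 hC) // rmorphD !rmorphM.
Qed.

Lemma evK_is_monoid_morphism : monoid_morphism (evK C).
Proof.
split=> [|x y].
  rewrite -[1](divff (oner_neq0 _)) -{1 2}tofrac1 evK_frac ?oner_eq0 //.
  by rewrite divff ?(evA_eq0 hC) ?oner_eq0.
rewrite (fraction_repr x) (fraction_repr y).
set u := (frac _).1; set v := (frac _).2.
set u' := (frac _).1; set v' := (frac _).2.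
have v0 : v != 0 by exact: denom_ratioP.
have v'0 : v' != 0 by exact: denom_ratioP.
rewrite mulf_div -!tofracM !evK_frac ?mulf_neq0 //.
by rewrite mulf_div !rmorphM.
Qed.

End Torsion.

(** * Sums over nonzero polynomials and over monic ones *)

Section Sums.
Variable F : finFieldType.
Local Notation r := #|F|.

(** The polynomials of degree less than m, with 0 included, as a list so that factorisation over a
    list of roots applies. *)
Definition npolys (m : nat) : seq {poly F} := [seq val a | a : {poly_m F}].

Lemma size_npolys m : size (npolys m) = (r ^ m)%N.
Proof. by rewrite size_map -cardE card_npoly. Qed.

Lemma npolys_uniq m : uniq (npolys m).
Proof. by rewrite map_inj_uniq ?enum_uniq //; apply: val_inj. Qed.

Lemma mem_npolys m a : (a \in npolys m) = (size a <= m)%N.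
Proof.
apply/mapP/idP => [[b _ ->]|sa]; first exact: size_npoly.
by exists (npolyp m a); rewrite ?mem_enum /= ?npolypK.
Qed.

(** Each nonzero polynomial is uniquely a unit of F times a monic one. An F-line thus contributes r
    - 1 equal terms, and r - 1 = -1 in L. *)
Lemma sum_npolys_neq0 (L : comNzRingType) (g : {rmorphism F -> L})
    (f : {poly F} -> L) (d : nat) :
  (forall c a, c != 0 -> f (c *: a) = f a) ->
  \sum_(a <- npolys d | a != 0) f a =
  - \sum_(d' < d)
      \sum_(a : {poly_(d'.+1) F} | ((a : {poly F}) \is monic)
                                   && (size (a : {poly F}) == d'.+1)) f a.
Proof.
move=> fZ; elim: d => [|d IH].
  rewrite big_ord0 oppr0 big1_seq // => a /andP[a0].
  by rewrite mem_npolys leqn0 size_poly_eq0 (negPf a0).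
rewrite big_ord_recr opprD -IH /=.
set M := [seq a <- npolys d.+1 | (a \is monic) && (size a == d.+1)].
have -> : \sum_(a : {poly_(d.+1) F} | ((a : {poly F}) \is monic)
            && (size (a : {poly F}) == d.+1)) f a = \sum_(a <- M) f a.
  by rewrite big_filter big_map enumT.
set U := [seq c <- enum F | c != 0].
have memM a : a \in M = (a \is monic) && (size a == d.+1).
  rewrite mem_filter mem_npolys; case: eqP => [->|]; last by rewrite !andbF.
  by rewrite leqnn andbT.
(* Nonzero polynomials of degree at most d: those of smaller degree, and the unit multiples of the
   monic ones of degree d. *)
have perm : perm_eq [seq a <- npolys d.+1 | a != 0]
    ([seq a <- npolys d | a != 0] ++ [seq c *: a | c <- U, a <- M]).
  apply: uniq_perm; first by rewrite filter_uniq // npolys_uniq.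
    rewrite cat_uniq filter_uniq ?npolys_uniq //=; apply/andP; split.
      apply/hasPn => _ /allpairsP[[c a] /= [cU aM ->]].
      rewrite mem_filter mem_npolys; move: aM cU.
      rewrite memM mem_filter => /andP[_ /eqP sa] /andP[c0 _].
      by rewrite size_scale // sa ltnn andbF.
    apply: allpairs_uniq.
    - exact/filter_uniq/enum_uniq.
    - exact/filter_uniq/npolys_uniq.
    move=> _ _ /allpairsP[[c a] /= [cU aM ->]]
      /allpairsP[[c' a'] /= [_ a'M ->]].
    move: cU aM a'M; rewrite !memM mem_filter.
    move=> /andP[c0 _] /andP[/eqP am _] /andP[/eqP a'm _] e.
    (* The leading coefficient of c a is c, so it recovers the scalar; cancelling it recovers a. *)
    have := congr1 lead_coef e; rewrite !lead_coefZ am a'm !mulr1 => ec.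
    by move: e; rewrite -ec => /(scalerI c0) ->.
  move=> a; rewrite mem_cat !mem_filter !mem_npolys.
  apply/andP/orP => [[a0]|[/andP[-> sa]|/allpairsP[[c b] /= [cU bM ->]]]].
  - rewrite leq_eqVlt ltnS => /orP[/eqP sa|sa]; last by left; rewrite a0.
    right; apply/allpairsP; exists (lead_coef a, (lead_coef a)^-1 *: a) => /=.
    have l0 : lead_coef a != 0 by rewrite lead_coef_eq0.
    rewrite memM mem_filter mem_enum l0 monicE lead_coefZ mulVf //.
    by rewrite size_scale ?invr_eq0 // sa !eqxx scalerA divff ?scale1r.
  - by rewrite leqW.
  - move: cU bM; rewrite mem_filter memM => /andP[c0 _] /andP[bm /eqP sb].
    by rewrite size_scale // sb leqnn scaler_eq0 negb_or c0 monic_neq0.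
rewrite -big_filter (perm_big _ perm) big_cat big_filter; congr (_ + _) => /=.
rewrite big_allpairs_dep /=.
rewrite (eq_big_seq (fun=> \sum_(a <- M) f a)) => [|c]; last first.
  by rewrite mem_filter => /andP[c0 _]; apply: eq_bigr => a _; rewrite fZ.
rewrite big_const_seq count_predT iter_addr_0 size_filter.
have -> : count (fun c => c != 0) (enum F) = r.-1.
  by rewrite -(cardC1 (0 : F)) cardE enumT /enum_mem size_filter.
apply/eqP; rewrite -addr_eq0 -mulrSr prednK ?(ltnW (card_gt1 F)) //.
by rewrite -mulr_natl (natr_card_eq0 g) mul0r.
Qed.
End Sums.

(** * Torsion points as roots of C_n, and their power sums *)

Section TorsionRoots.
Variables (R : realType) (F : finFieldType) (C : valued_ext R F).
Hypothesis hC : is_Cinfty C.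
Variables (pi : C) (n : {poly F}).
Hypotheses (hpi : carlitz_period pi) (hn : n \is monic).
Local Notation r := #|F|.
Local Notation d := (size n).-1.
Local Notation tors a := (carlitz_eval a (lambda pi n)).

HB.instance Definition _ := GRing.isNmodMorphism.Build _ _ (evK C)
  (evK_is_nmod_morphism hC).
HB.instance Definition _ := GRing.isMonoidMorphism.Build _ _ (evK C)
  (evK_is_monoid_morphism hC).

Lemma evK_tofrac a : evK C (tofrac a) = evA C a.
Proof.
rewrite -[tofrac a]divr1 -tofrac1 (evK_frac hC) ?oner_eq0 //.
by rewrite rmorph1 divr1.
Qed.

Let n0 : evA C n != 0. Proof. by rewrite (evA_eq0 hC) monic_neq0. Qed.
Let d1 : d.+1 = size n.
Proof. by rewrite prednK // size_poly_gt0 monic_neq0. Qed.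

Lemma torsionE a : tors a = expC (evA C a * (pi / evA C n)).
Proof. exact: (carlitz_eval_expC hC). Qed.

Lemma torsionZ c a : tors (c *: a) = Defs.iota C c * tors a.
Proof. by rewrite !torsionE -(expC_iota hC) evAZ -mulrA. Qed.

Lemma torsion0 : tors 0 = 0.
Proof. by rewrite -(scale0r 0) torsionZ rmorph0 mul0r. Qed.

Lemma torsionB a b : tors (a - b) = tors a - tors b.
Proof.
rewrite -scaleN1r !torsionE rmorphD mulrDl (expCD hC) -!torsionE torsionZ.
by rewrite rmorphN rmorph1 mulN1r.
Qed.

(** The kernel of exp_C is A pi, so vanishing at a pi / n forces n to divide a, which the degree
    allows only for a = 0. *)
Lemma torsion_eq0 (a : {poly F}) : (size a < size n)%N -> tors a = 0 -> a = 0.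
Proof.
move=> sa; rewrite torsionE => /hpi.2[c e].
have {}e : a = c * n.
  apply: (evA_inj hC); rewrite rmorphM /=; apply: (mulIf hpi.1).
  by rewrite -mulrA (mulrC (evA C n)) mulrA -e; field.
have [c0|c0] := eqVneq c 0; first by rewrite e c0 mul0r.
move: sa; rewrite e ltnNge size_proper_mul; last first.
  by rewrite mulf_neq0 ?lead_coef_eq0 // monic_neq0.
by rewrite -(prednK (_ : 0 < size c)%N) ?size_poly_gt0 // addSn leq_addl.
Qed.

Lemma torsion_inj : {in npolys F d &, injective (fun a => tors a)}.
Proof.
move=> a b; rewrite !mem_npolys => sa sb e; apply/eqP; rewrite -subr_eq0.
apply/eqP/torsion_eq0; last by rewrite torsionB e subrr.
rewrite -d1 ltnS (leq_trans (size_polyD _ _)) // size_polyN geq_max sa.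
exact: sb.
Qed.

(** C_n is monic of degree r^d and kills the r^d distinct points exp_C(a pi / n), since it sends
    them to exp_C(a pi) = 0. *)
Lemma carlitz_prod : map_poly (evA C) (carlitz n) =
  \prod_(a <- npolys F d) ('X - (tors a)%:P).
Proof.
have [cm cs] := carlitz_monic hn.
rewrite [LHS](@all_roots_prod_XsubC _ _ [seq tors a | a <- npolys F d]).
- by rewrite big_map (eqP (monic_map _ cm)) scale1r.
- rewrite size_map size_npolys size_map_inj_poly ?rmorph0 //.
  exact: (@evA_inj _ _ _ hC).
- apply/allP => _ /mapP[a _ ->]; rewrite /root -/(carlitz_eval n _) torsionE.
  rewrite (carlitz_eval_expC hC) mulrCA [evA C n * _]mulrCA divff // mulr1.
  by apply/eqP/hpi.2; exists a.
- by rewrite uniq_rootsE map_inj_in_uniq ?npolys_uniq //; apply: torsion_inj.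
Qed.

(** By [carlitz_prod], the sum runs over all nonzero n-torsion points of the Carlitz module. *)
Definition torsion_power_sum (m : nat) : C :=
  \sum_(a <- npolys F d | a != 0) tors a ^- m.

(** With S_i the power sums, this is C_n(X) (1 - \sum_(i >= 1) S_i X^i) = n X, that is, X times the
    logarithmic derivative formula. The coefficient 1 at i = 0 comes from the root 0. *)
Lemma torsion_recurrence m :
  \sum_(i < m.+1) (if val i == 0 then 1 else - torsion_power_sum i)
     * (map_poly (evA C) (carlitz n))`_(m - i) = evA C n * (m == 1)%:R.
Proof.
set p := map_poly _ _.
set rs := [seq tors a | a <- npolys F d & a != 0].
have prs : p = \prod_(x <- rs) ('X - x%:P) * 'X.
  rewrite /p carlitz_prod.
  rewrite (bigD1_seq 0) ?npolys_uniq ?mem_npolys ?size_poly0 //=.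
  by rewrite torsion0 subr0 mulrC /rs big_map -big_filter.
have rs0 x : x \in rs -> x != 0.
  move=> /mapP[a]; rewrite mem_filter mem_npolys => /andP[a0 sa] ->.
  by apply: contraNneq a0 => /torsion_eq0-> //; rewrite -d1 ltnS.
case: m => [|m].
  by rewrite big_ord1 mul1r coef_map /= carlitz_coef0 rmorph0 mulr0.
have := deriv_prod_XsubC_coef m rs0; rewrite -prs /=.
rewrite /p deriv_map deriv_carlitz map_polyC coefC -/p /=.
rewrite eqSS [LHS](_ : _ = evA C n * (m == 0%N)%:R); last first.
  by case: eqP => _; rewrite ?mulr1 ?mulr0.
(* Reversing the index puts the i = 0 term, the contribution of the root 0, last. *)
move=> ->; rewrite (reindex_inj rev_ord_inj) big_ord_recr /= subSS subnn mul1r.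
rewrite subn0 addrC -sumrN; congr (_ + _); apply: eq_bigr => i _.
rewrite subSS subn_eq0 leqNgt ltn_ord mulNr mulrC; congr (- (_ * _)).
  by rewrite subKn // ltnW // ltnS.
by rewrite /torsion_power_sum /rs big_map big_filter.
Qed.

(** Substituting n X for X in the generating identity replaces C_n(X / n) by C_n(X), whence the
    factor n^i and the same recurrence as for the power sums. *)
Lemma dBC_recurrence m :
  \sum_(i < m.+1) (evK C (dBC n i / tofrac (Gamma_succ F i)) * evA C n ^+ i)
     * (map_poly (evA C) (carlitz n))`_(m - i) = evA C n * (m == 1)%:R.
Proof.
have -> : evA C n * (m == 1)%:R = evA C n ^+ m * (m == 1)%:R.
  by case: eqP => [->|_]; rewrite ?expr1 ?mulr0.
rewrite -(rmorph_nat (evK C)) -(dBC_generating m (monic_neq0 hn)).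
rewrite [X in _ = _ * X]rmorph_sum mulr_sumr; apply: eq_bigr => i _.
rewrite [X in _ = _ * X]rmorphM /= carlitz_scaled_coef.
rewrite -tofracXn (evK_frac hC); last first.
  by rewrite expf_neq0 ?monic_neq0.
rewrite coef_map /= rmorphXn /=.
rewrite -[in evA C n ^+ m](@subnKC i m) -1?ltnS // exprD.
set x := evK _ _; set y := evA C (_`__).
have n1 : evA C n ^+ (m - i) != 0 by rewrite expf_neq0.
by rewrite mulrACA (mulrC _ x) (mulrCA _ y) divff // mulr1.
Qed.

(** Both sequences convolve with the coefficients of C_n to the same result, so they agree;
    positivity of s avoids the exceptional value at 0. *)
Lemma dBC_torsion s : (0 < s)%N ->
  evK C (dBC n s / tofrac (Gamma_succ F s)) * evA C n ^+ s
  = - torsion_power_sum s.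
Proof.
move=> s0.
pose p k := (map_poly (evA C) (carlitz n))`_k.
pose b i := evK C (dBC n i / tofrac (Gamma_succ F i)) * evA C n ^+ i.
pose b' i := if i == 0 then 1 else - torsion_power_sum i.
suff : b s = b' s by rewrite /b' eqn0Ngt s0.
apply: (@convolution_inj _ p) => [||m].
- by rewrite /p coef_map /= carlitz_coef0 rmorph0.
- by rewrite /p coef_map /= carlitz_coef1.
- by rewrite [LHS]dBC_recurrence [RHS]torsion_recurrence.
Qed.

(** Divisibility of s by r - 1 makes C_a(lambda)^-s invariant under scaling a by units of F, so
    monic sums become sums over all nonzero a. The denominator of the bracket supplies lambda^s. *)
Lemma Hsum_lt_torsion s : (r.-1 %| s)%N ->
  Hsum_lt d s (lambda pi n) = - torsion_power_sum s * lambda pi n ^+ s.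
Proof.
move=> hs; rewrite /torsion_power_sum.
rewrite (sum_npolys_neq0 (Defs.iota C)); last first.
  move=> c a c0; rewrite torsionZ exprMn -rmorphXn /= expf_card_dvd //.
  by rewrite rmorph1 mul1r.
rewrite opprK mulr_suml; apply: eq_bigr => i _.
rewrite mulr_suml; apply: eq_bigr => a _.
by rewrite /bracket expr_div_n invf_div mulrC.
Qed.
End TorsionRoots.

Theorem theorem3p15 (R : realType) (F : finFieldType) (C : valued_ext R F)
  (hC : is_Cinfty C) (pi : C) (hpi : carlitz_period pi)
  (s : nat) (hs0 : (0 < s)%N) (hs : (#|F|.-1 %| s)%N)
  (n : {poly F}) (hn : n \is monic) :
  Hsum_lt (size n).-1 s (lambda pi n) / (evA C n * lambda pi n) ^+ s
    = evK C (dBC n s / tofrac (Gamma_succ F s))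
  /\ exists k : {fraction {poly F}},
       Hsum_lt (size n).-1 s (lambda pi n) = evK C k * lambda pi n ^+ s.
Proof.
have n0 : evA C n != 0 by rewrite (evA_eq0 hC) monic_neq0.
have eK := dBC_torsion hC hpi hn hs0.
have eH := Hsum_lt_torsion hC pi n hs.
have -> : evK C (dBC n s / tofrac (Gamma_succ F s))
    = - torsion_power_sum pi n s / evA C n ^+ s.
  by rewrite -eK mulfK ?expf_neq0.
split.
  (* This occurs for n = 1, where lambda = exp_C(pi) = 0. Since 0^-1 = 0 here and C_a(0) = 0, both
     sides vanish. *)
  have [l0|l0] := eqVneq (lambda pi n) 0.
    have -> : torsion_power_sum pi n s = 0.
      rewrite /torsion_power_sum l0 big1 // => a _.
      rewrite /carlitz_eval horner_coef0 coef_map /= carlitz_coef0 rmorph0.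
      by rewrite expr0n eqn0Ngt hs0 invr0.
    by rewrite l0 mulr0 expr0n eqn0Ngt hs0 invr0 mulr0 oppr0 mul0r.
  by rewrite eH exprMn invfM mulrACA divff ?mulr1 ?expf_neq0.
(* The identity with denominators cleared; it involves no division by lambda, so lambda = 0 is
   covered. *)
exists (dBC n s / tofrac (Gamma_succ F s) * tofrac n ^+ s).
rewrite eH -eK -tofracXn.
by rewrite [in RHS](evK_is_monoid_morphism hC).2 evK_tofrac ?rmorphXn.
Qed.
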